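(* Let $R$ be a ring and $G$ be a nilpotent group. Then the group ring $RG$ is a UNC ring if and only if $R$ is a UNC ring and $G$ is a $2$-group.
   Context: Rings are associative with identity, not necessarily commutative. An element $a$ of a ring $S$ is nil-clean if $a=e+b$ with $e^2=e\in S$ and $b\in S$ nilpotent ($e$ and $b$ need not commute). A ring $S$ is a UNC ring if every unit of $S$ is nil-clean. $RG$ is the group ring of $G$ over $R$. A group is a $2$-group if the order of each of its elements is a (finite) power of $2$. A group $G$ (possibly infinite) is nilpotent if $G=\mathcal Z_n(G)$ for some finite $n$, where $\mathcal Z_0(G)=1$ and $\mathcal Z_{i+1}(G)/\mathcal Z_i(G)$ is the center of $G/\mathcal Z_i(G)$ (the upper central series).
   Formalization: The ring R is assumed to be nonzero (1 ≠ 0): for the zero ring, RG is the zero ring and hence UNC for every nilpotent group G, for example the cyclic group of order 3, which is not a 2-group. *)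

(* Defs.v *)
From HB Require Import structures.
From mathcomp Require Import all_boot all_algebra finmap monalg.

Set Implicit Arguments.
Unset Strict Implicit.
Unset Printing Implicit Defensive.

Import GRing.Theory.

Local Open Scope fset_scope.
Local Open Scope ring_scope.

(* [monalg] puts a product on {malg R[K]} only when K is a [monomType], a class
   of monoids that contains no nontrivial group. [grpring] reuses its finitely
   supported functions K -> R and their addition; the product is the
   convolution product over an arbitrary [groupType]. *)
Definition grpring (R : nzRingType) (G : groupType) : Type := {malg R[G]}.

HB.instance Definition _ (R : nzRingType) (G : groupType) :=
  GRing.Zmodule.copy (grpring R G) {malg R[G]}.

Section GroupRing.
Variables (R : nzRingType) (G : groupType).

Implicit Types (a b c : {malg R[G]}) (g h k : G).

Definition gr_one : {malg R[G]} := << 1 *g 1%g >>.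

Definition gr_mul a b : {malg R[G]} :=
  \sum_(g <- msupp a) \sum_(h <- msupp b) << a@_g * b@_h *g (g * h)%g >>.

Lemma gr_mulw (d1 d2 : {fset G}) a b :
  msupp a `<=` d1 -> msupp b `<=` d2 ->
  gr_mul a b = \sum_(g <- d1) \sum_(h <- d2) << a@_g * b@_h *g (g * h)%g >>.
Proof.
move=> le_d1 le_d2; rewrite /gr_mul (big_fset_incl _ le_d1) /=.
  apply/eq_bigr=> g _; apply/big_fset_incl => // h _ /mcoeff_outdom ->.
  by rewrite mulr0 monalgU0.
move=> g _ /mcoeff_outdom ag0.
by rewrite big1 => // h _; rewrite ag0 mul0r monalgU0.
Qed.

Lemma gr_mulUU (r s : R) g h :
  gr_mul << r *g g >> << s *g h >> = << r * s *g (g * h)%g >>.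
Proof. by rewrite (gr_mulw msuppU_le msuppU_le) !big_seq_fset1 !mcoeffUU. Qed.

Lemma gr_mulUl (r : R) g b :
  gr_mul << r *g g >> b = \sum_(h <- msupp b) << r * b@_h *g (g * h)%g >>.
Proof.
rewrite (gr_mulw msuppU_le (fsubset_refl _)) big_seq_fset1.
by apply/eq_bigr => h _; rewrite mcoeffUU.
Qed.

Lemma gr_mulUr (r : R) g a :
  gr_mul a << r *g g >> = \sum_(h <- msupp a) << a@_h * r *g (h * g)%g >>.
Proof.
rewrite (gr_mulw (fsubset_refl _) msuppU_le); apply/eq_bigr => h _.
by rewrite big_seq_fset1 mcoeffUU.
Qed.

Lemma gr_mul1l : left_id gr_one gr_mul.
Proof.
move=> a; rewrite gr_mulUl [RHS]monalgE.
by apply/eq_bigr=> g _; rewrite mul1r mul1g.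
Qed.

Lemma gr_mul1r : right_id gr_one gr_mul.
Proof.
move=> a; rewrite gr_mulUr [RHS]monalgE.
by apply/eq_bigr=> g _; rewrite mulr1 mulg1.
Qed.

Lemma gr_mulDl : left_distributive gr_mul +%R.
Proof.
move=> a b c; rewrite (gr_mulw (msuppD_le _ _) (fsubset_refl _)).
rewrite (gr_mulw (fsubsetUl _ (msupp b)) (fsubset_refl _)).
rewrite (gr_mulw (fsubsetUr (msupp a) _) (fsubset_refl _)).
rewrite -big_split /=; apply/eq_bigr=> g _.
rewrite -big_split /=; apply/eq_bigr=> h _.
by rewrite mcoeffD mulrDl monalgUD.
Qed.

Lemma gr_mulDr : right_distributive gr_mul +%R.
Proof.
move=> c a b; rewrite (gr_mulw (fsubset_refl _) (msuppD_le _ _)).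
rewrite (gr_mulw (fsubset_refl _) (fsubsetUl _ (msupp b))).
rewrite (gr_mulw (fsubset_refl _) (fsubsetUr (msupp a) _)).
rewrite -big_split /=; apply/eq_bigr=> g _.
rewrite -big_split /=; apply/eq_bigr=> h _.
by rewrite mcoeffD mulrDr monalgUD.
Qed.

Lemma gr_mul0l : left_zero 0 gr_mul.
Proof. by move=> a; rewrite /gr_mul msupp0 big_seq_fset0. Qed.

Lemma gr_mul0r : right_zero 0 gr_mul.
Proof. by move=> a; rewrite /gr_mul msupp0 big1 // => g _; rewrite big_seq_fset0. Qed.

Lemma gr_mulA : associative gr_mul.
Proof.
move=> a b c.
have suml (I : Type) (s : seq I) (F : I -> {malg R[G]}) d :
    gr_mul (\sum_(i <- s) F i) d = \sum_(i <- s) gr_mul (F i) d.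
  exact: (big_morph (gr_mul^~ d) (fun _ _ => gr_mulDl _ _ _) (gr_mul0l _)).
have sumr (I : Type) (s : seq I) (F : I -> {malg R[G]}) d :
    gr_mul d (\sum_(i <- s) F i) = \sum_(i <- s) gr_mul d (F i).
  exact: (big_morph (gr_mul d) (fun _ _ => gr_mulDr _ _ _) (gr_mul0r _)).
rewrite [a]monalgE !suml; apply/eq_bigr=> g _.
rewrite [b]monalgE suml !sumr suml; apply/eq_bigr=> h _.
rewrite [c]monalgE !sumr; apply/eq_bigr=> k _.
by rewrite !gr_mulUU mulrA mulgA.
Qed.

Lemma gr_one_neq0 : gr_one != 0.
Proof. by rewrite monalgU_eq0 oner_eq0. Qed.

HB.instance Definition _ := GRing.Zmodule_isNzRing.Build (grpring R G)
  gr_mulA gr_mul1l gr_mul1r gr_mulDl gr_mulDr gr_one_neq0.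

End GroupRing.

Section UNC.
Variable S : nzRingType.

(* [GRing.unit] would require a [unitRingType] structure, which a
   noncommutative group ring does not have in general. *)
Definition invertible (u : S) : Prop := exists2 v : S, u * v = 1 & v * u = 1.

Definition nilpotent_elt (b : S) : Prop := exists n : nat, b ^+ n = 0.

Definition nil_clean (a : S) : Prop :=
  exists e b : S, [/\ e * e = e, nilpotent_elt b & a = e + b].

Definition UNC : Prop := forall u : S, invertible u -> nil_clean u.

End UNC.

Section Groups.
Variable G : groupType.
Local Open Scope group_scope.

Definition in_lcoset (H : G -> Prop) (x z : G) : Prop :=
  exists2 h : G, H h & z = x * h.

(* With Z_i := upper_central i, x is in Z_(i+1) when its coset x Z_i is central
   in G / Z_i: (x y) Z_i = (y x) Z_i for every y. *)
Fixpoint upper_central (i : nat) : G -> Prop :=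
  if i is j.+1 then
    fun x => forall y z : G, in_lcoset (upper_central j) (x * y) z
                         <-> in_lcoset (upper_central j) (y * x) z
  else fun x => x = 1.

Definition nilpotent_grp : Prop :=
  exists n : nat, forall x : G, upper_central n x.

Definition has_order (x : G) (n : nat) : Prop :=
  [/\ (0 < n)%N, x ^+ n = 1 &
      forall m : nat, (0 < m)%N -> x ^+ m = 1 -> (n <= m)%N].

Definition two_group : Prop :=
  forall x : G, exists k : nat, has_order x (2 ^ k).

(* Each Z_i is a normal subgroup, so that G / Z_i makes sense, and Z_(i+1) has
   the usual description by commutators. *)
Lemma upper_central_facts (i : nat) :
  [/\ upper_central i 1,
      forall x y, upper_central i x -> upper_central i y ->
        upper_central i (x * y),
      forall x, upper_central i x -> upper_central i x^-1,
      forall x y, upper_central i x -> upper_central i (x ^ y) &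
      forall x, upper_central i.+1 x <-> forall y, upper_central i [~ x, y]].
Proof.
have commE H : H 1 -> (forall x y, H x -> H y -> H (x * y)) ->
    (forall x, H x -> H x^-1) -> forall x,
    (forall y z, in_lcoset H (x * y) z <-> in_lcoset H (y * x) z)
    <-> (forall y, H [~ x, y]).
  move=> H1 HM HV x; have E y : [~ x, y] = (y * x)^-1 * (x * y).
    by rewrite /commg /conjg invgM !mulgA.
  split=> [cx y|cx y z].
    have /(cx y)[h Hh xy] : in_lcoset H (x * y) (x * y) by exists 1; rewrite ?mulg1.
    by rewrite E xy mulKg.
  have {}cx := cx y; rewrite E in cx.
  split=> -[h Hh ->].
    by exists ((y * x)^-1 * (x * y) * h); [exact: HM | rewrite !mulgA mulgV mul1g].
  exists (((y * x)^-1 * (x * y))^-1 * h); first by apply: HM => //; apply: HV.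
  by rewrite invgM invgK !mulgA mulgV mul1g.
elim: i => [|i [IH1 IHM IHV IHJ IHC]].
  split=> //= [x y -> ->|x ->|x y ->|x]; rewrite ?mulg1 ?invg1 ?conj1g //.
  by apply: (commE (eq^~ 1)) => // [a b -> ->|a ->]; rewrite ?mulg1 ?invg1.
have H1 : upper_central i.+1 1 by apply/IHC => y; rewrite comm1g.
have HM x y : upper_central i.+1 x -> upper_central i.+1 y ->
    upper_central i.+1 (x * y).
  move=> /IHC cx /IHC cy; apply/IHC => z.
  suff -> : [~ x * y, z] = [~ x, z] ^ y * [~ y, z] by apply: IHM => //; apply: IHJ.
  by rewrite /commg /conjg !invgM !mulgA !mulgK.
have HV x : upper_central i.+1 x -> upper_central i.+1 x^-1.
  move=> /IHC cx; apply/IHC => z.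
  suff -> : [~ x^-1, z] = ([~ x, z] ^ x^-1)^-1 by apply/IHV/IHJ.
  by rewrite /commg /conjg !invgM !invgK !mulgA !mulgK.
split=> //.
  move=> x y /IHC cx; apply/IHC => z.
  suff -> : [~ x ^ y, z] = [~ x, z ^ y^-1] ^ y by apply: IHJ.
  by rewrite conjRg conjgKV.
exact: (commE (upper_central i.+1)).
Qed.

End Groups.

(* Main.v *)
(** Let N be the upper nilradical (the sum of all nil ideals) of RG, which is
itself nil. If RG is UNC, then so is R by augmentation, and 2 is nilpotent. For x
in Z_(i+1)(G), write x = e + b with e idempotent and b nilpotent. If z - 1 lies
in N for every z in Z_i(G), then x is a unit that is central modulo N, which
forces e = 1. Hence x - 1 = b is nilpotent and, being central modulo N, lies in
N, so the induction along the upper central series goes on. As 2 is nilpotent,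
the expansion of x ^ 2^k modulo 2 shows that x has 2-power order. Conversely, if
G is a 2-group and 2 is nilpotent, the same induction puts every x - 1 in N, so
the augmentation ideal is nil and a nil-clean decomposition of the augmentation
of a unit lifts to one of the unit. *)

Require Import Defs.
From HB Require Import structures.
From mathcomp Require Import all_boot all_algebra finmap monalg.

Set Implicit Arguments.
Unset Strict Implicit.
Unset Printing Implicit Defensive.

Import GRing.Theory.

Local Open Scope ring_scope.

(** * Nil ideals, and elements central modulo a nil ideal *)

Section UpperNilradical.
Variable S : nzRingType.
Implicit Types (a b c x y : S) (I J : S -> Prop).

Definition ideal I : Prop :=
  [/\ I 0, forall x y, I x -> I y -> I (x + y),
      forall a x, I x -> I (a * x) & forall a x, I x -> I (x * a)].

Definition nil_ideal I : Prop := ideal I /\ forall x, I x -> nilpotent_elt x.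

(** Encoded as the union of all nil ideals; it equals their sum because the sum of two nil ideals is
    again nil. *)
Definition upper_nilradical a : Prop := exists2 I, nil_ideal I & I a.

Lemma idealN I x : ideal I -> I x -> I (- x).
Proof. by case=> _ _ IM _ Ix; rewrite -mulN1r; apply: IM. Qed.

Lemma idealB I x y : ideal I -> I x -> I y -> I (x - y).
Proof.
by move=> idI Ix Iy; case: (idI) => _ ID _ _; apply: ID => //; apply: idealN.
Qed.

Lemma ideal_sub_eq I x y : ideal I -> I (x - y) -> I y -> I x.
Proof. by move=> [_ ID _ _] Ixy Iy; rewrite -(subrK y x); apply: ID. Qed.

Lemma ideal_subX I a b n : ideal I -> I (a - b) -> I (a ^+ n - b ^+ n).
Proof.
move=> idI Iab; case: (idI) => I0 ID IMl IMr.
elim: n => [|n IHn]; first by rewrite subrr.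
have -> : a ^+ n.+1 - b ^+ n.+1 = a * (a ^+ n - b ^+ n) + (a - b) * b ^+ n.
  by rewrite !exprS mulrBr mulrBl addrA subrK.
by apply: ID; [apply: IMl | apply/IMr].
Qed.

Lemma nil_ideal_ext I J :
  nil_ideal I -> ideal J -> (forall x, J x -> exists n, I (x ^+ n)) ->
  nil_ideal J.
Proof.
move=> [_ nilI] idJ JI; split=> // x /JI[n /nilI[m xnm]].
by exists (n * m)%N; rewrite exprM.
Qed.

(** Modulo [I], an element of [I + J] agrees with its component in [J], so one of its powers falls
    into [I]. *)
Lemma nil_ideal_sum I J : nil_ideal I -> nil_ideal J ->
  nil_ideal (fun a => exists2 x, I x & J (a - x)).
Proof.
move=> nI [idJ nilJ]; case: (nI) => idI _; case: (idI) => I0 ID IMl IMr.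
case: (idJ) => J0 JD JMl JMr.
apply: (nil_ideal_ext nI).
  split=> [|a b [x Ix Jx] [y Iy Jy]|a b [x Ix Jx]|a b [x Ix Jx]].
  - by exists 0; rewrite ?subrr.
  - by exists (x + y); [apply: ID | rewrite opprD addrACA; apply: JD].
  - by exists (a * x); [apply: IMl | rewrite -mulrBr; apply: JMl].
  - by exists (x * a); [apply: IMr | rewrite -mulrBl; apply: JMr].
move=> a [x Ix /nilJ[n axn]]; exists n.
apply: (ideal_sub_eq idI (y := (a - x) ^+ n)); last by rewrite axn.
by apply: ideal_subX => //; rewrite opprB addrC subrK.
Qed.

Lemma nil_ideal0 : nil_ideal (eq^~ 0).
Proof.
split; last by move=> x ->; exists 1%N.
by split=> // [x y -> ->|a x ->|a x ->]; rewrite ?addr0 ?mulr0 ?mul0r.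
Qed.

Lemma nil_ideal_upper_nilradical : nil_ideal upper_nilradical.
Proof.
split; last by move=> x [I [_]]; apply.
split.
- by exists (eq^~ 0) => //; apply: nil_ideal0.
- move=> x y [I nI Ix] [J nJ Jy]; exists (fun a => exists2 z, I z & J (a - z)).
    exact: nil_ideal_sum.
  by exists x => //; rewrite addrAC subrr add0r.
- by move=> a x [I nI Ix]; exists I => //; case: nI => -[_ _ IM _] _; apply: IM.
- by move=> a x [I nI Ix]; exists I => //; case: nI => -[_ _ _ IM] _; apply: IM.
Qed.

Definition central_mod I c : Prop := forall s, I (c * s - s * c).

(** The ideal [c S + N] is nil: as [c] is central modulo [N], [(c s) ^+ n] is congruent to
    [c ^+ n * s ^+ n], which vanishes for suitable [n]. *)
Lemma central_mod_nil c :
  central_mod upper_nilradical c -> nilpotent_elt c -> upper_nilradical c.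
Proof.
set N := upper_nilradical => cc [n cn].
have nN := nil_ideal_upper_nilradical; have [idN _] := nN.
have [N0 ND NMl NMr] := idN.
exists (fun a => exists s, N (a - c * s)); last first.
  by exists 1; rewrite mulr1 subrr.
apply: (nil_ideal_ext nN).
  split=> [|a b [s Ns] [t Nt]|a b [s Ns]|a b [s Ns]].
  - by exists 0; rewrite mulr0 subrr.
  - by exists (s + t); rewrite mulrDr opprD addrACA; apply: ND.
  (* Closure under left multiplication is where centrality enters: [a * c] is replaced by [c * a]
     modulo [N]. *)
  - exists (a * s); rewrite mulrA.
    have -> : a * b - c * a * s = a * (b - c * s) - (c * a - a * c) * s.
      by rewrite mulrBr mulrBl !mulrA opprB addrA subrK.
    by apply: (idealB idN); [apply: NMl | apply/NMr/cc].
  - by exists (s * a); rewrite mulrA -mulrBl; apply: NMr.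
move=> a [s Ns]; exists n; apply: (ideal_sub_eq idN (ideal_subX n idN Ns)).
suff H k : N ((c * s) ^+ k - c ^+ k * s ^+ k).
  by apply: (ideal_sub_eq idN (H n)); rewrite cn mul0r.
elim: k => [|k IHk]; first by rewrite !expr0 mulr1 subrr.
have comm_ck t : N (t * c ^+ k - c ^+ k * t).
  elim: {IHk} k => [|k IHk]; first by rewrite mulr1 mul1r subrr.
  have -> : t * c ^+ k.+1 - c ^+ k.+1 * t =
      (t * c ^+ k - c ^+ k * t) * c - c ^+ k * (c * t - t * c).
    by rewrite exprSr mulrBl mulrBr !mulrA opprB addrA subrK.
  by apply: (idealB idN); [apply: NMr | apply/NMl/cc].
have -> : (c * s) ^+ k.+1 - c ^+ k.+1 * s ^+ k.+1 =
    c * s * ((c * s) ^+ k - c ^+ k * s ^+ k)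
      + c * (s * c ^+ k - c ^+ k * s) * s ^+ k.
  rewrite [c ^+ _]exprS [s ^+ _]exprS exprS !mulrBr mulrBl !mulrA.
  by rewrite addrA subrK.
by apply: ND; [apply: NMl | apply/NMr/NMl/comm_ck].
Qed.

Lemma idem_nil (e : S) : e * e = e -> nilpotent_elt e -> e = 0.
Proof.
move=> ee [n en]; case: n en => [|n].
  by rewrite expr0 => /eqP; rewrite oner_eq0.
suff -> : e ^+ n.+1 = e by [].
by elim: n => // n IHn; rewrite exprS IHn.
Qed.

(* With [f = 1 - e] one has [f b = f u], so modulo a nil ideal where [u] is
   central [0 = f b ^+ n = u ^+ n f]; hence [f] is nilpotent, and [f = 0]. *)
Lemma nil_clean_central_unit I (u : S) : nil_ideal I -> central_mod I u ->
  invertible u -> nil_clean u -> nilpotent_elt (u - 1).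
Proof.
move=> [idI nilI] cu [v uv vu] [e [b [ee nb defu]]].
have [n bn] := nb; have [I0 ID IMl IMr] := idI.
move deff : (1 - e) => f.
have fe : f * e = 0 by rewrite -deff mulrBl mul1r ee subrr.
have ff : f * f = f by rewrite -{2}deff mulrBr mulr1 fe subr0.
have fu : f * b = f * u by rewrite defu mulrDr fe add0r.
have H k : I (u ^+ k * f - f * b ^+ k).
  elim: k => [|k IHk]; first by rewrite mul1r mulr1 subrr.
  have -> : u ^+ k.+1 * f - f * b ^+ k.+1 =
      u * (u ^+ k * f - f * b ^+ k) + (u * f - f * u) * b ^+ k.
    by rewrite !exprS (mulrA f b) fu mulrBr mulrBl !mulrA addrA subrK.
  by apply: ID; [apply: IMl | apply/IMr/cu].
have vun : v ^+ n * u ^+ n = 1.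
  elim: n {bn} => [|n IHn]; first by rewrite mulr1.
  by rewrite exprSr exprS mulrA -(mulrA _ v) vu mulr1.
have If : I f.
  rewrite -[f]mul1r -vun -mulrA; apply: IMl.
  by have := H n; rewrite bn mulr0 subr0.
suff e1 : e = 1 by rewrite defu e1 addrAC subrr add0r.
apply/esym/eqP; rewrite -subr_eq0 deff; apply/eqP.
exact: idem_nil ff (nilI f If).
Qed.

(** The unit [-1] is central, so [-1 - 1] is nilpotent. *)
Lemma UNC_nil2 : UNC S -> nilpotent_elt (2%:R : S).
Proof.
move=> uncS.
have inv : invertible (-1 : S) by exists (-1); rewrite mulrNN mulr1.
have [|n Hn] := nil_clean_central_unit nil_ideal0 _ inv (uncS _ inv).
  by move=> s; rewrite mulN1r mulrN1 subrr.
exists n; move: Hn; rewrite -opprD exprNn => /(congr1 ( *%R ((-1) ^+ n))).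
by rewrite mulrA -expr2 sqrr_sign mul1r mulr0.
Qed.

Lemma sub1X_pow2 x k :
  exists t, x ^+ (2 ^ k) = 1 + (x - 1) ^+ (2 ^ k) + t *+ 2.
Proof.
elim: k => [|k [t IHk]].
  by exists 0; rewrite mul0rn addr0 !expr1 addrC subrK.
set y := (x - 1) ^+ (2 ^ k) in IHk.
(* Half of what remains of [(1 + y + t *+ 2) ^+ 2] after removing [1 + y ^+ 2], with the order of
   factors kept. *)
exists (y + (1 + y) * t + t * (1 + y) + t * t *+ 2).
rewrite expnSr !exprM IHk -/y !expr2 [LHS]mulrDl 2![_ * (_ + t *+ 2)]mulrDr.
rewrite [(1 + y) * (1 + y)]mulrDl [y * (1 + y)]mulrDr mul1r mulr1.
rewrite !mulrnAl !mulrnAr !mulrnDl.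
rewrite !addrA; do 8![congr (_ + _)].
by rewrite -!addrA; congr (_ + _); rewrite addrA addrC.
Qed.

Lemma nilpotent_mul2 (t : S) :
  nilpotent_elt (2%:R : S) -> nilpotent_elt (t *+ 2).
Proof.
move=> [n n2]; exists n; rewrite -mulr_natl exprMn_comm ?n2 ?mul0r //.
exact/commr_sym/commr_nat.
Qed.

Lemma nilpotentX x n : nilpotent_elt (x ^+ n) -> nilpotent_elt x.
Proof. by case=> m xnm; exists (n * m)%N; rewrite exprM. Qed.

Lemma nilpotent_sub1 x k : nilpotent_elt (2%:R : S) ->
  x ^+ (2 ^ k) = 1 -> nilpotent_elt (x - 1).
Proof.
move=> nil2 xk; have [t] := sub1X_pow2 x k; rewrite xk => E.
apply: (@nilpotentX _ (2 ^ k)).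
have -> : (x - 1) ^+ (2 ^ k) = (- t) *+ 2.
  by apply/eqP; rewrite mulNrn -addr_eq0 -(inj_eq (addrI 1)) addr0 addrA -E.
exact: nilpotent_mul2.
Qed.

Lemma nilpotent_sub1_pow2 x : nilpotent_elt (x - 1) ->
  exists k t, x ^+ (2 ^ k) = 1 + t *+ 2.
Proof.
move=> [n xn]; have [t xE] := sub1X_pow2 x n; exists n, t; rewrite xE.
(* The nilpotency exponent [n] itself serves as [k], since [2 ^ n] exceeds it. *)
have /subnK <- : (n <= 2 ^ n)%N by apply/ltnW/ltn_expl.
by rewrite exprD xn mulr0 addr0.
Qed.

End UpperNilradical.

(** * Monomials and the augmentation of the group ring *)

Section GroupRing.
Variables (R : nzRingType) (G : groupType).
Local Notation RG := (grpring R G).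
Local Notation N := (@upper_nilradical RG).
Implicit Types (a b : RG) (r s : R) (g h x y : G).

Definition mon r g : RG := << r *g g >>.

Lemma monM r s g h : mon r g * mon s h = mon (r * s) (g * h)%g.
Proof. exact: gr_mulUU. Qed.

Lemma mon1 : mon 1 1%g = 1.
Proof. by []. Qed.

Lemma mon0 g : mon 0 g = 0.
Proof. exact: monalgU0. Qed.

Lemma monD r s g : mon (r + s) g = mon r g + mon s g.
Proof. exact: monalgUD. Qed.

Lemma monX r n : mon r 1%g ^+ n = mon (r ^+ n) 1%g.
Proof. by elim: n => [|n IHn] //; rewrite !exprS IHn monM mulg1. Qed.

Lemma gmonX g n : mon 1 g ^+ n = mon 1 (g ^+ n)%g.
Proof. by elim: n => [|n IHn] //; rewrite exprS IHn monM mul1r expgS. Qed.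

Lemma invertible_gmon g : invertible (mon 1 g).
Proof. by exists (mon 1 g^-1%g); rewrite monM mulr1 ?mulgV ?mulVg. Qed.

Lemma grpring_ind (P : RG -> Prop) :
  P 0 -> (forall a b, P a -> P b -> P (a + b)) -> (forall r g, P (mon r g)) ->
  forall a, P a.
Proof.
by move=> P0 PD PU a; rewrite [a]monalgE; apply: big_ind => // g _; apply: PU.
Qed.

Definition augmentation : RG -> R := mmap (@idfun R) (fun _ : G => 1).

Lemma augmentationD a b :
  augmentation (a + b) = augmentation a + augmentation b.
Proof. exact: raddfD. Qed.

Lemma augmentation0 : augmentation 0 = 0.
Proof. exact: raddf0. Qed.

Lemma augmentation_mon r g : augmentation (mon r g) = r.
Proof. by rewrite /augmentation /mon mmapU mulr1. Qed.

Lemma augmentationM a b :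
  augmentation (a * b) = augmentation a * augmentation b.
Proof.
elim/grpring_ind: a => [|a a' IHa IHa'|r g].
- by rewrite mul0r augmentation0 mul0r.
- by rewrite mulrDl !augmentationD IHa IHa' mulrDl.
elim/grpring_ind: b => [|b b' IHb IHb'|s h].
- by rewrite mulr0 augmentation0 mulr0.
- by rewrite mulrDr !augmentationD IHb IHb' mulrDr.
- by rewrite monM !augmentation_mon.
Qed.

Lemma augmentation1 : augmentation 1 = 1.
Proof. by rewrite -mon1 augmentation_mon. Qed.

Lemma augmentationX a n : augmentation (a ^+ n) = augmentation a ^+ n.
Proof.
elim: n => [|n IHn]; first exact: augmentation1.
by rewrite !exprS augmentationM IHn.
Qed.

Lemma nilpotent_mon1 r : nilpotent_elt r -> nilpotent_elt (mon r 1%g).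
Proof. by case=> n rn; exists n; rewrite monX rn mon0. Qed.

Lemma nilpotent2_grpring :
  nilpotent_elt (2%:R : R) -> nilpotent_elt (2%:R : RG).
Proof. by move/nilpotent_mon1; rewrite monD. Qed.

(** On monomials this is the identity [x h - h x = h x ([~ x, h] - 1)]; sums follow by
    additivity. *)
Lemma central_mod_gmon I x : ideal I ->
  (forall y, I (mon 1 [~ x, y]%g - 1)) -> central_mod I (mon 1 x).
Proof.
move=> idI Ix; have [I0 ID IMl _] := idI.
apply: grpring_ind => [|a b Ia Ib|r h].
- by rewrite mulr0 mul0r subrr.
- by rewrite mulrDr mulrDl opprD addrACA; apply: ID.
have -> : mon 1 x * mon r h - mon r h * mon 1 x =
    mon r (h * x)%g * (mon 1 [~ x, h]%g - 1).
  rewrite mulrBr mulr1 !monM mul1r !mulr1; congr (mon r _ - _).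
  by rewrite /commg /conjg !mulgA mulgK mulgV mul1g.
exact: IMl.
Qed.

(* Modulo [N], which contains [z - 1] for [z] in Z_i, the elements of Z_(i+1)
   are central. *)
Lemma upper_nilradical_gmon :
  (forall x, central_mod N (mon 1 x) -> nilpotent_elt (mon 1 x - 1)) ->
  nilpotent_grp G -> forall x, N (mon 1 x - 1).
Proof.
move=> nilc [n Zn] x; move: {Zn} (Zn x).
have [idN _] := nil_ideal_upper_nilradical RG.
have [N0 _ _ _] := idN.
elim: n x => [|n IHn] x /=; first by move=> ->; rewrite mon1 subrr.
have [_ _ _ _ ZC] := upper_central_facts G n.
move/ZC => Zx.
have cx : central_mod N (mon 1 x).
  by apply: central_mod_gmon => // y; apply: IHn.
(* Subtracting 1 from [mon 1 x] leaves its additive commutators unchanged. *)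
apply: central_mod_nil (nilc x cx) => s.
by rewrite mulrBl mulrBr mul1r mulr1 opprB addrA subrK.
Qed.

(** The augmentation ideal lies in [N], since [r g - r = r (g - 1)] on monomials. *)
Lemma upper_nilradical_augmentation :
  (forall x, N (mon 1 x - 1)) ->
  forall a, N (a - mon (augmentation a) 1%g).
Proof.
move=> Nx; have [[N0 ND NMl _] _] := nil_ideal_upper_nilradical RG.
apply: grpring_ind => [|a b Na Nb|r g].
- by rewrite augmentation0 mon0 subrr.
- by rewrite augmentationD monD opprD addrACA; apply: ND.
have -> : mon r g - mon (augmentation (mon r g)) 1%g =
    mon r 1%g * (mon 1 g - 1).
  by rewrite mulrBr mulr1 monM mulr1 mul1g augmentation_mon.
exact: NMl.
Qed.

(** If the power of [x] were not 1, comparing coefficients at the identity would make 1 a multiple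
    of the nilpotent 2. *)
Lemma expg_pow2_eq1 x k (t : RG) : nilpotent_elt (2%:R : R) ->
  mon 1 x ^+ (2 ^ k) = 1 + t *+ 2 -> (x ^+ (2 ^ k) = 1)%g.
Proof.
move=> [n n2]; rewrite gmonX; set y := (x ^+ _)%g => E.
apply/eqP/negPn/negP => y1.
have /esym t1 : 0 = 1 + t@_1%g *+ 2.
  rewrite -mcoeffMn -[1 in RHS](mcoeffUU (1%g : G)) -mcoeffD.
  by rewrite -[<<_ *g 1%g>>]/(1 : RG) -E mcoeffU (negbTE y1).
have : (2%:R * - t@_1%g) ^+ n = 1.
  by rewrite mulrN mulr_natl -(addr0_eq t1) opprK expr1n.
rewrite exprMn_comm; last exact/commr_sym/commr_nat.
by rewrite n2 mul0r => /esym/eqP; rewrite oner_eq0.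
Qed.

End GroupRing.

(** * Orders of group elements and the equivalence *)

Lemma has_order_pow2 (G : groupType) (x : G) k :
  (x ^+ (2 ^ k) = 1)%g -> exists j, has_order x (2 ^ j).
Proof.
move=> xk.
have ex_n : exists n, (0 < n)%N && (x ^+ n == 1)%g.
  by exists (2 ^ k)%N; rewrite expn_gt0 xk eqxx.
case: (ex_minnP ex_n) => n /andP[n_gt0 /eqP xn] n_min.
(* A nonzero remainder of [2 ^ k] modulo [n] would be a smaller positive exponent killing [x]. *)
have : (n %| 2 ^ k)%N.
  rewrite /dvdn; case: posnP => // r_gt0.
  have /n_min : (0 < 2 ^ k %% n)%N && (x ^+ (2 ^ k %% n) == 1)%g.
    rewrite r_gt0; move: xk; rewrite {1}(divn_eq (2 ^ k) n).
    by rewrite expgnDr mulnC expgnA xn expg1n mul1g => ->; rewrite eqxx.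
  by rewrite leqNgt ltn_pmod.
case/dvdn_pfactor => // j _ nE; exists j; rewrite -nE; split=> // m m_gt0 xm.
by apply: n_min; rewrite m_gt0 xm eqxx.
Qed.

Theorem theorem2p21 (R : nzRingType) (G : groupType) (hG : nilpotent_grp G) :
  UNC (grpring R G) <-> UNC R /\ two_group G.
Proof.
split=> [uncRG|[uncR G2]].
  (* A unit of [R] is also one of the group ring, and the augmentation carries its decomposition
     back to [R]. *)
  have uncR : UNC R.
    move=> u [v uv vu].
    have [|e [b [ee [n bn] E]]] := uncRG (mon u (1%g : G)).
      by exists (mon v 1%g); rewrite monM mulg1 ?uv ?vu.
    exists (augmentation e), (augmentation b); split.
    - by rewrite -augmentationM ee.
    - by exists n; rewrite -augmentationX bn augmentation0.
    - by rewrite -augmentationD -E augmentation_mon.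
  split=> // x.
  have nilN := nil_ideal_upper_nilradical (grpring R G).
  have Nx := @upper_nilradical_gmon R G _ hG x.
  have /nilN.2/nilpotent_sub1_pow2[k [t xk]] :
      upper_nilradical (mon 1 x - 1 : grpring R G).
    apply: Nx => y cy; apply: (nil_clean_central_unit nilN cy).
      exact: invertible_gmon.
    exact/uncRG/invertible_gmon.
  exact: has_order_pow2 (expg_pow2_eq1 (UNC_nil2 uncR) xk).
have nil2 := nilpotent2_grpring G (UNC_nil2 uncR).
have [idN nilN] := nil_ideal_upper_nilradical (grpring R G).
have Nx (x : G) : upper_nilradical (mon 1 x - 1 : grpring R G).
  apply: upper_nilradical_gmon => // y _; have [k [_ yk _]] := G2 y.
  by apply: (nilpotent_sub1 (k := k)); rewrite // gmonX yk.
move=> u [v uv vu].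
have [|e [b [ee [n bn] E]]] := uncR (augmentation u).
  by exists (augmentation v); rewrite -augmentationM ?uv ?vu augmentation1.
(* The idempotent [e] lifts as a constant; modulo the nilradical, [u] is its augmentation, so the
   remainder is congruent to the nilpotent [mon b 1%g]. *)
exists (mon e 1%g), (u - mon e 1%g); split; last by rewrite addrC subrK.
  by rewrite monM mulg1 ee.
apply: (@nilpotentX _ _ n); apply: nilN.
apply: (ideal_sub_eq idN (y := mon b 1%g ^+ n)); last first.
  by rewrite monX bn mon0; case: idN.
apply: ideal_subX => //; rewrite -addrA -opprD -monD -E.
exact: upper_nilradical_augmentation.
Qed.
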